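(* For every positive integer $k$, \textsc{Upper Clique Transversal} can be solved in linear time in the class of graphs of cliquewidth at most $k$ if the input graph is given with a $k$-expression. That is, for every fixed positive integer $k$ there is a linear-time algorithm that, given a graph $G$ together with a $k$-expression of $G$ and an integer $\ell$, decides whether $G$ contains a minimal clique transversal $S$ with $|S|\ge \ell$.
   Context: All graphs are finite, simple, and undirected. A clique is a set of pairwise adjacent vertices; it is maximal if it is not properly contained in another clique. A clique transversal in $G$ is a set $S\subseteq V(G)$ that intersects every maximal clique of $G$; it is minimal if it does not contain any other clique transversal. \textsc{Upper Clique Transversal} is the decision problem: given a graph $G$ and an integer $\ell$, does $G$ contain a minimal clique transversal $S$ such that $|S|\ge \ell$? A $k$-expression of $G$ is a construction of a graph isomorphic to $G$ in which each vertex is equipped with a label from $L=\{1,\dots,k\}$, using the operations: (1) creation of a new graph with a single vertex $v$ having label $i\in L$; (2) disjoint union of two already constructed labeled graphs; (3) for two distinct labels $i,j\in L$, addition of all edges between every vertex with label $i$ and every vertex with label $j$; (4) for two distinct labels $i,j\in L$, relabeling every vertex with label $i$ to have label $j$. The cliquewidth of $G$ is the minimum $k$ such that $G$ admits a $k$-expression. The integer $k$ bounding the cliquewidth is a fixed constant, and linear time means linear in the size of the input (the graph with its given $k$-expression). *)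

(* Defs.v *)
From HB Require Import structures.
From mathcomp Require Import all_boot all_order all_algebra.

Set Implicit Arguments.
Unset Strict Implicit.
Unset Printing Implicit Defensive.

Record sgraph := SGraph {
  vertex :> finType;
  adj : rel vertex;
  adj_sym : symmetric adj;
  adj_irr : irreflexive adj
}.
Arguments adj {s} : rename.

Definition isomorphic (G H : sgraph) : Prop :=
  exists2 f : G -> H, bijective f & {mono f : u v / adj u v}.

Definition clique (G : sgraph) (K : {set G}) : bool :=
  [forall u in K, forall v in K, (u != v) ==> adj u v].

Definition maximal_clique (G : sgraph) (K : {set G}) : bool :=
  maxset (@clique G) K.

Definition clique_transversal (G : sgraph) (S : {set G}) : bool :=
  [forall K : {set G}, maximal_clique K ==> (S :&: K != set0)].

Definition minimal_clique_transversal (G : sgraph) (S : {set G}) : bool :=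
  minset (@clique_transversal G) S.

Definition upper_clique_transversal (G : sgraph) (l : int) : Prop :=
  exists S : {set G}, minimal_clique_transversal S /\ (l <= #|S|%:Z)%R.

Record lgraph (k : nat) := LGraph {
  lgraph_graph :> sgraph;
  label : lgraph_graph -> 'I_k
}.

Section LabeledGraphOperations.
Variable k : nat.
Implicit Types (G H : lgraph k) (i j : 'I_k).

Lemma single_sym : symmetric (fun _ _ : unit => false). Proof. by []. Qed.
Lemma single_irr : irreflexive (fun _ _ : unit => false). Proof. by []. Qed.

Definition lg_single i : lgraph k :=
  @LGraph k (SGraph single_sym single_irr) (fun=> i).

Definition union_adj G H : rel (G + H) := fun x y =>
  match x, y with
  | inl u, inl v => adj u v
  | inr u, inr v => adj u v
  | _, _ => false
  end.

Lemma union_sym G H : symmetric (@union_adj G H).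
Proof. by case=> u [] v //=; rewrite adj_sym. Qed.

Lemma union_irr G H : irreflexive (@union_adj G H).
Proof. by case=> u /=; rewrite adj_irr. Qed.

Definition lg_union G H : lgraph k :=
  @LGraph k (SGraph (@union_sym G H) (@union_irr G H))
    (fun x => match x with inl u => label u | inr v => label v end).

Definition join_adj i j G : rel G := fun u v =>
  [|| adj u v, (label u == i) && (label v == j)
             | (label u == j) && (label v == i)].

Lemma join_sym i j G : symmetric (@join_adj i j G).
Proof.
move=> u v; rewrite /join_adj adj_sym; congr (_ || _).
by rewrite orbC; congr (_ || _); rewrite andbC.
Qed.

Lemma join_irr i j (ij : i != j) G : irreflexive (@join_adj i j G).
Proof.
move=> u; rewrite /join_adj adj_irr andbC orbb /=.
by apply/negP=> /andP[/eqP-> /eqP ji]; rewrite ji eqxx in ij.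
Qed.

Definition lg_join i j (ij : i != j) G : lgraph k :=
  @LGraph k (SGraph (@join_sym i j G) (@join_irr i j ij G)) (@label k G).

Definition lg_relabel i j G : lgraph k :=
  @LGraph k G (fun u : G => if label u == i then j else label u).

End LabeledGraphOperations.

(* Vertices are unnamed: those of [kgraph t] are the leaves of [t]. *)
Inductive kexpr (k : nat) : Type :=
| KVertex (i : 'I_k)
| KUnion (t1 t2 : kexpr k)
| KJoin (i j : 'I_k) (ij : i != j) (t : kexpr k)
| KRelabel (i j : 'I_k) (ij : i != j) (t : kexpr k).

Fixpoint kgraph k (t : kexpr k) : lgraph k :=
  match t with
  | KVertex i => lg_single i
  | KUnion t1 t2 => lg_union (kgraph t1) (kgraph t2)
  | KJoin i j ij t => lg_join ij (kgraph t)
  | KRelabel i j _ t => lg_relabel i j (kgraph t)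
  end.

Definition kexpr_of k (t : kexpr k) (G : sgraph) : Prop :=
  isomorphic (kgraph t) G.

(* Word RAM with finitely many registers in use, a memory indexed by words, and
   unit cost per instruction.  Words are the naturals below a capacity [W]; an
   instruction whose result does not fit gets the machine stuck, as does a
   program counter outside of the program.  Below, [r], [s], [t] are registers,
   standing for their contents on the right of [:=] and inside [mem[_]]. *)

Inductive instr : Type :=
| IConst (r x : nat)     (* r := x *)
| IAdd (r s t : nat)     (* r := s + t *)
| ISub (r s t : nat)     (* r := s - t, truncated at 0 *)
| ILoad (r s : nat)      (* r := mem[s] *)
| IStore (r s : nat)     (* mem[r] := s *)
| IJumpZ (r a : nat)     (* goto a if r = 0 *)
| IHalt (b : bool).      (* accept or reject *)

Definition program := seq instr.

Record state := State {
  counter : nat;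
  register : nat -> nat;
  memory : nat -> nat
}.

Definition set_reg (W : nat) (s : state) (r v : nat) : option (state + bool) :=
  if v < W then
    Some (inl (State (counter s).+1 [eta register s with r |-> v] (memory s)))
  else None.

Definition step (W : nat) (P : program) (s : state) : option (state + bool) :=
  if onth P (counter s) is Some i then
    match i with
    | IConst r x => set_reg W s r x
    | IAdd r a b => set_reg W s r (register s a + register s b)
    | ISub r a b => set_reg W s r (register s a - register s b)
    | ILoad r a => set_reg W s r (memory s (register s a))
    | IStore r a =>
        Some (inl (State (counter s).+1 (register s)
                     [eta memory s with register s r |-> register s a]))
    | IJumpZ r a =>
        Some (inl (State (if register s r == 0 then a else (counter s).+1)
                     (register s) (memory s)))
    | IHalt b => Some (inr b)
    end
  else None.

(* [run W P T s = Some b] : from [s], [P] halts with answer [b] after executing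
   at most [T] instructions. *)
Fixpoint run (W : nat) (P : program) (T : nat) (s : state) : option bool :=
  if T is T'.+1 then
    match step W P s with
    | Some (inl s') => run W P T' s'
    | Some (inr b) => Some b
    | None => None
    end
  else None.

(* The input occupies memory cells 0, ..., size w - 1, its length is in
   register 0, and everything else is 0. *)
Definition init (w : seq nat) : state :=
  State 0 [eta (fun=> 0) with 0 |-> size w] (nth 0 w).

(* The capacity is polynomial in the length of the input and its largest entry,
   i.e., words have O(log (size w + max w)) bits. *)
Definition capacity (c : nat) (w : seq nat) : nat :=
  (size w + \max_(x <- w) x + 2) ^ c.

(* [repr x w] : the word sequence [w] is a representation of the instance [x];
   the algorithm has to work on all representations. *)
Definition solvable_in_linear_time (I : Type) (repr : I -> seq nat -> Prop)
    (yes : I -> Prop) : Prop :=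
  exists (P : program) (c : nat), forall (x : I) (w : seq nat), repr x w ->
    exists b : bool,
      run (capacity c w) P (c * size w) (init w) = Some b /\ (b <-> yes x).

(* Adjacency lists: [s] numbers the vertices and [N u] lists the neighbours
   of [u]. *)
Definition graph_repr (G : sgraph) (w : seq nat) : Prop :=
  exists (s : seq G) (N : G -> seq G),
    [/\ uniq s, s =i predT, forall u, uniq (N u), forall u, N u =i adj u
      & w = size s ::
            flatten [seq size (N u) :: [seq index v s | v <- N u] | u <- s]].

(* Postfix notation: the operations in the order in which they are performed. *)
Fixpoint kexpr_code k (t : kexpr k) : seq nat :=
  match t with
  | KVertex i => [:: 0; val i]
  | KUnion t1 t2 => kexpr_code t1 ++ kexpr_code t2 ++ [:: 1]
  | KJoin i j _ t => kexpr_code t ++ [:: 2; val i; val j]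
  | KRelabel i j _ t => kexpr_code t ++ [:: 3; val i; val j]
  end.

Definition int_code (l : int) : seq nat := [:: nat_of_bool (l < 0)%R; `|l|%N].

Record uct_instance (k : nat) := UCTInstance {
  uct_graph : sgraph;
  uct_expr : kexpr k;
  uct_exprP : kexpr_of uct_expr uct_graph;
  uct_bound : int
}.

Definition uct_repr k (x : uct_instance k) (w : seq nat) : Prop :=
  exists2 g, graph_repr (uct_graph x) g &
    w = int_code (uct_bound x) ++
        (size (kexpr_code (uct_expr x)) :: kexpr_code (uct_expr x)) ++ g.

Definition uct_yes k (x : uct_instance k) : Prop :=
  upper_clique_transversal (uct_graph x) (uct_bound x).

(* Main.v *)
Require Import Defs.
From HB Require Import structures.
From mathcomp Require Import all_boot all_order all_algebra.
From mathcomp Require Import zify.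

(* [S] is a minimal clique transversal iff it meets every maximal clique and each
   of its vertices is the only vertex of [S] in some maximal clique.  Whether this holds is determined by
   the set of labeled "vertex types" (membership in [S], in the clique [K], in a
   set [X] that is empty or a singleton, the label, and the labels of the
   non-neighbours in [K]), collected over all vertices, then over all [K], then
   over all [X].  For a fixed number of labels there are finitely many such nested
   types, and the type of a set in a union, join or relabeling is a function of
   the types of its parts.  Hence a k-expression in postfix notation can be
   evaluated with a stack of constant-size tables that store, for each type, the
   largest size of a set of that type. *)

Set Implicit Arguments.
Unset Strict Implicit.
Unset Printing Implicit Defensive.

(** * Types of vertex sets *)

Section Types.
Variable k : nat.
Implicit Types G H : lgraph k.

Definition vtype := (bool * bool * bool * 'I_k * {set 'I_k})%type.

(** Labels suffice here: a later join or relabeling treats all vertices of one label alike. Since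
    [v] itself is excluded, the set is empty for every member of a clique. *)
Definition nonnbr_labels G (K : {set G}) (v : G) : {set 'I_k} :=
  [set label u | u in [set u in K | (u != v) && ~~ adj u v]].

Definition vertex_type G (S X K : {set G}) (v : G) : vtype :=
  (v \in S, v \in X, v \in K, label v, nonnbr_labels K v).

Definition clique_type G (S X K : {set G}) : {set vtype} :=
  [set vertex_type S X K v | v : G].

Definition trace_type G (S X : {set G}) : {set {set vtype}} :=
  [set clique_type S X K | K : {set G}].

Definition stype := ({set {set vtype}} * {set {set {set vtype}}})%type.
HB.instance Definition _ := Finite.on stype.

Definition uct_type G (S : {set G}) : stype :=
  (trace_type S set0, [set trace_type S [set x] | x in S]).

(* For [D = clique_type S X K]: [K] is a maximal clique and [S :&: K = X]. *)
Definition is_witness (D : {set vtype}) : bool :=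
  [forall d in D, let: (s, x, m, _, A) := d in
    (s && m == x) && (m == (A == set0))].

(** The first component, with [X] empty, detects a maximal clique missed by [S]; the second, with
    [X] a singleton, detects a maximal clique private to that vertex of [S]. *)
Definition accepting (t : stype) : bool :=
  ~~ [exists D in t.1, is_witness D] &&
  [forall E in t.2, exists D in (E : {set {set vtype}}), is_witness D].

Lemma nonnbr_labels0 G (K : {set G}) v :
  reflect (forall u, u \in K -> u != v -> adj u v) (nonnbr_labels K v == set0).
Proof.
apply: (iffP idP) => [/eqP N0 u uK uv | Kv].
  apply/negPn/negP => nuv.
  suff: label u \in nonnbr_labels K v by rewrite N0 inE.
  by apply: imset_f; rewrite inE uK uv.
rewrite -subset0; apply/subsetP => _ /imsetP[u + ->].
by rewrite inE => /and3P[uK /(Kv _ uK) ->].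
Qed.

Lemma cliqueP (G : sgraph) (K : {set G}) :
  reflect (forall u v, u \in K -> v \in K -> u != v -> adj u v) (clique K).
Proof.
apply: (iffP forall_inP) => [cK u v uK vK | cK u uK].
  by move/forall_inP: (cK u uK) => /(_ v vK) /implyP.
by apply/forall_inP => v vK; apply/implyP; apply: cK.
Qed.

(** [K] is a maximal clique iff it consists exactly of the vertices adjacent to all other members of
    [K]: members having this property makes [K] a clique, non-members lacking it makes [K]
    maximal. *)
Lemma is_witnessE G (S X K : {set G}) :
  is_witness (clique_type S X K) = maximal_clique K && (S :&: K == X).
Proof.
apply/forall_inP/andP => [wK | [/maxsetP[/cliqueP cK maxK] /eqP SKX]].
  have {}wK v : (v \in S :&: K) = (v \in X) /\
      (v \in K) = (nonnbr_labels K v == set0).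
    have /andP[/eqP + /eqP] := wK _ (imset_f (vertex_type S X K) (isT : v \in G)).
    by rewrite in_setI.
  split; last by apply/eqP/setP => v; case: (wK v).
  apply/maxsetP; split=> [|K' /cliqueP cK' sKK'].
    apply/cliqueP => u v uK vK uv.
    by have [_] := wK v; rewrite vK => /esym/nonnbr_labels0; apply.
  apply/eqP; rewrite eqEsubset sKK' andbT; apply/subsetP => v vK'.
  have [_ ->] := wK v; apply/nonnbr_labels0 => u uK.
  by apply: cK' => //; apply: (subsetP sKK').
move=> _ /imsetP[v _ ->] /=; rewrite -in_setI SKX eqxx /=; apply/eqP.
apply/idP/nonnbr_labels0 => [vK u uK | Kv]; first exact: cK.
suff <- : v |: K = K by rewrite setU11.
apply: maxK (subsetUr _ _); apply/cliqueP => u w.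
rewrite !inE => /predU1P[-> | uK] /predU1P[-> | wK] uw.
- by rewrite eqxx in uw.
- by rewrite adj_sym Kv // eq_sym.
- exact: Kv.
- exact: cK.
Qed.

Lemma trace_typeP G (S X : {set G}) :
  reflect (exists2 K : {set G}, maximal_clique K & S :&: K = X)
          [exists D in trace_type S X, is_witness D].
Proof.
apply: (iffP exists_inP) => [[_ /imsetP[K _ ->]] | [K mK SK]].
  by rewrite is_witnessE => /andP[mK /eqP SK]; exists K.
by exists (clique_type S X K); rewrite ?imset_f // is_witnessE mK SK eqxx.
Qed.

(** If [S :&: K = [set x]], then a transversal inside [S] must contain [x], as it meets [K].
    Conversely, if [S] is minimal, then [S :\ x] misses some maximal clique, which [S] can only meet
    in [x]. *)
Lemma acceptingE G (S : {set G}) :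
  accepting (uct_type S) = minimal_clique_transversal S.
Proof.
have tr0 (S' : {set G}) : ~~ [exists D in trace_type S' set0, is_witness D] =
    clique_transversal S'.
  apply/idP/forallP => [/trace_typeP nK K | tS].
    by apply/implyP => mK; apply/negP => /eqP SK; apply: nK; exists K.
  apply/trace_typeP => -[K mK SK].
  by move/implyP: (tS K) => /(_ mK); rewrite SK eqxx.
rewrite /accepting /= tr0.
apply/andP/minsetP => [[tS /forall_inP priv] | [tS minS]]; split=> //.
  move=> S' tS' sS'S; apply/eqP; rewrite eqEsubset sS'S /=.
  apply/subsetP => x xS.
  have /trace_typeP[K mK SK] := priv _ (imset_f _ xS).
  move/forallP/(_ K)/implyP: tS' => /(_ mK) /set0Pn[y].
  rewrite inE => /andP[yS' yK].
  have: y \in S :&: K by rewrite inE (subsetP sS'S).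
  by rewrite SK inE => /eqP <-.
apply/forall_inP => _ /imsetP[x xS ->]; apply/trace_typeP.
have: ~~ clique_transversal (S :\ x).
  apply/negP => /minS /(_ (subsetDl _ _)) /setP/(_ x).
  by rewrite xS !inE eqxx.
rewrite -tr0 negbK => /trace_typeP[K mK SxK]; exists K => //.
apply/eqP; rewrite eqEsubset; apply/andP; split.
  apply/subsetP => y; rewrite !inE => /andP[yS yK]; apply/negPn/negP => yx.
  by have: y \in (S :\ x) :&: K; [rewrite !inE yx yS | rewrite SxK inE].
rewrite sub1set; move/forallP/(_ K)/implyP: tS => /(_ mK) /set0Pn[y].
rewrite inE => /andP[yS yK]; case: (eqVneq y x) => [<-| yx].
  by rewrite inE yS.
by have: y \in (S :\ x) :&: K; [rewrite !inE yx yS | rewrite SxK inE].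
Qed.

(** * Types under join and relabeling *)

Definition map_type (h : vtype -> vtype) (t : stype) : stype :=
  ([set h @: (D : {set vtype}) | D in t.1],
   [set [set h @: (D : {set vtype}) | D in (E : {set {set vtype}})] | E in t.2]).

(** The two graphs are built explicitly on one carrier [V], so that the same [S], [X] and [K] can be
    typed in both. A map on vertex types then passes through the nested images. *)
Lemma uct_type_map (h : vtype -> vtype) (V : finType) (a1 a2 : rel V)
    a1s a1i a2s a2i (l1 l2 : V -> 'I_k)
    (G := @LGraph k (@SGraph V a1 a1s a1i) l1)
    (H := @LGraph k (@SGraph V a2 a2s a2i) l2) :
  (forall S X K v,
     @vertex_type H S X K v = h (@vertex_type G S X K v)) ->
  forall S : {set V}, @uct_type H S = map_type h (@uct_type G S).
Proof.
move=> vh S.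
have clh X K : @clique_type H S X K = h @: (@clique_type G S X K).
  by rewrite -imset_comp; apply: eq_imset => v; apply: vh.
have trh X : @trace_type H S X =
    [set h @: (D : {set vtype}) | D in @trace_type G S X].
  by rewrite /trace_type -imset_comp; apply: eq_imset => K; apply: clh.
congr pair; first exact: trh.
by rewrite -imset_comp; apply: eq_imset => x; apply: trh.
Qed.

(** The join makes a vertex labeled [a] adjacent to all vertices whose label is matched with [a], so
    exactly these labels disappear from its non-neighbours. *)
Definition join_vtype (i j : 'I_k) (d : vtype) : vtype :=
  let: (s, x, m, a, A) := d in
  (s, x, m, a, [set b in A | ~~ ((b == i) && (a == j) || (b == j) && (a == i))]).

Lemma uct_type_join i j (ij : i != j) G (S : {set G}) :
  @uct_type (lg_join ij G) S = map_type (join_vtype i j) (uct_type S).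
Proof.
case: G S => -[V a a_sym a_irr] l S; apply: uct_type_map => {}S X K v.
rewrite /vertex_type /=; congr pair; apply/setP => b; rewrite inE.
apply/imsetP/andP => [[u] | [/imsetP[u + ->] nij]].
  rewrite inE /= /join_adj negb_or => /and4P[uK uv nuv nij] ->.
  by split=> //; apply: imset_f; rewrite inE uK uv.
rewrite inE => /and3P[uK uv nuv]; exists u => //.
by rewrite inE uK uv /= /join_adj negb_or nuv.
Qed.

Definition relabel_vtype (i j : 'I_k) (d : vtype) : vtype :=
  let: (s, x, m, a, A) := d in
  let r b := if b == i then j else b in (s, x, m, r a, r @: A).

Lemma uct_type_relabel i j G (S : {set G}) :
  @uct_type (lg_relabel i j G) S = map_type (relabel_vtype i j) (uct_type S).
Proof.
case: G S => -[V a a_sym a_irr] l S; apply: uct_type_map => {}S X K v.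
by rewrite /vertex_type /=; congr pair; rewrite -imset_comp.
Qed.

(** * Types under disjoint union *)

Definition sum_set (V1 V2 : finType) (S1 : {set V1}) (S2 : {set V2}) :
    {set V1 + V2} :=
  [set z | match z with inl u => u \in S1 | inr v => v \in S2 end].

Lemma sum_setE (V1 V2 : finType) (S : {set V1 + V2}) :
  S = sum_set (inl @^-1: S) (inr @^-1: S).
Proof. by apply/setP => -[u|v]; rewrite !inE. Qed.

Lemma card_sum_set (V1 V2 : finType) (S1 : {set V1}) (S2 : {set V2}) :
  #|sum_set S1 S2| = #|S1| + #|S2|.
Proof.
have -> : sum_set S1 S2 = (inl @: S1) :|: (inr @: S2).
  apply/setP => -[u|v]; rewrite !inE.
    rewrite mem_imset; last by move=> ? ? [].
    by case: imsetP => [[? ?]//|_]; rewrite orbF.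
  rewrite [X in _ || X]mem_imset; last by move=> ? ? [].
  by case: imsetP => [[? ?]//|_].
rewrite cardsU !card_imset; try by move=> ? ? [].
rewrite (_ : _ :&: _ = set0) ?cards0 ?subn0 //.
apply/setP => z; rewrite !inE; apply/negP => /andP[/imsetP[u _ ->]].
by case/imsetP.
Qed.

(* The labels that occur in [K], recovered from [D = clique_type S X K]. *)
Definition clique_labels (D : {set vtype}) : {set 'I_k} :=
  [set d.1.2 | d in [set d in D | d.1.1.2]].

(** No edge crosses a disjoint union, so each vertex gains as non-neighbours all clique vertices of
    the other side; [B] is the set of their labels. *)
Definition add_nonnbrs (B : {set 'I_k}) (d : vtype) : vtype :=
  (d.1, d.2 :|: B).

Definition union_ctype (D1 D2 : {set vtype}) : {set vtype} :=
  add_nonnbrs (clique_labels D2) @: D1 :|: add_nonnbrs (clique_labels D1) @: D2.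

Definition union_trace (E1 E2 : {set {set vtype}}) : {set {set vtype}} :=
  [set union_ctype D1 D2 | D1 in E1, D2 in E2].

(** A singleton [X] lies on one side and leaves the empty set on the other, hence each trace in a
    second component is paired with the first component of the other operand. *)
Definition union_type (t1 t2 : stype) : stype :=
  (union_trace t1.1 t2.1,
   [set union_trace E t2.1 | E in t1.2] :|: [set union_trace t1.1 E | E in t2.2]).

Lemma clique_labelsE G (S X K : {set G}) :
  clique_labels (clique_type S X K) = [set label v | v in K].
Proof.
apply/setP => a; apply/imsetP/imsetP => [[d] | [v vK ->]].
  by rewrite inE => /andP[/imsetP[v _ ->] /= vK] ->; exists v.
by exists (vertex_type S X K v); rewrite // inE imset_f.
Qed.

Lemma clique_type_union G H (S1 X1 K1 : {set G}) (S2 X2 K2 : {set H}) :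
  @clique_type (lg_union G H) (sum_set S1 S2) (sum_set X1 X2) (sum_set K1 K2) =
  union_ctype (clique_type S1 X1 K1) (clique_type S2 X2 K2).
Proof.
have vl u : @vertex_type (lg_union G H) (sum_set S1 S2) (sum_set X1 X2)
    (sum_set K1 K2) (inl u) =
    add_nonnbrs [set label v | v in K2] (vertex_type S1 X1 K1 u).
  rewrite /vertex_type /add_nonnbrs /= !inE; congr pair.
  apply/setP => b; rewrite !inE; apply/imsetP/orP => [[[w|w]] | ].
  - by rewrite !inE /= => /and3P[wK wu nwu] ->;
    left; apply: imset_f; rewrite inE wK nwu andbT.
  - by rewrite !inE /= => /andP[wK _] ->; right; apply: imset_f.
  case=> /imsetP[w]; rewrite ?inE.
    by case/and3P=> wK wu nwu ->; exists (inl w); rewrite // !inE wK nwu andbT.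
  by move=> wK ->; exists (inr w); rewrite // !inE wK.
have vr u : @vertex_type (lg_union G H) (sum_set S1 S2) (sum_set X1 X2)
    (sum_set K1 K2) (inr u) =
    add_nonnbrs [set label v | v in K1] (vertex_type S2 X2 K2 u).
  rewrite /vertex_type /add_nonnbrs /= !inE; congr pair.
  apply/setP => b; rewrite !inE; apply/imsetP/orP => [[[w|w]] | ].
  - by rewrite !inE /= => /andP[wK _] ->; right; apply: imset_f.
  - by rewrite !inE /= => /and3P[wK wu nwu] ->;
    left; apply: imset_f; rewrite inE wK nwu andbT.
  case=> /imsetP[w]; rewrite ?inE.
    by case/and3P=> wK wu nwu ->; exists (inr w); rewrite // !inE wK nwu andbT.
  by move=> wK ->; exists (inl w); rewrite // !inE wK.
rewrite /union_ctype !clique_labelsE; apply/setP => d; rewrite inE.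
apply/imsetP/orP => [[[u|u] _ ->] | [] /imsetP[_ /imsetP[u _ ->] ->]].
- by left; rewrite vl; apply/imset_f/imset_f.
- by right; rewrite vr; apply/imset_f/imset_f.
- by exists (inl u) => //; rewrite vl.
- by exists (inr u) => //; rewrite vr.
Qed.

Lemma trace_type_union G H (S1 X1 : {set G}) (S2 X2 : {set H}) :
  @trace_type (lg_union G H) (sum_set S1 S2) (sum_set X1 X2) =
  union_trace (trace_type S1 X1) (trace_type S2 X2).
Proof.
apply/setP => D; apply/imsetP/imset2P.
  case=> K _ ->; rewrite (sum_setE K) clique_type_union.
  by eexists; [apply: imset_f | apply: imset_f | ].
case=> _ _ /imsetP[K1 _ ->] /imsetP[K2 _ ->] ->.
by exists (sum_set K1 K2); rewrite ?clique_type_union.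
Qed.

Lemma uct_type_union G H (S1 : {set G}) (S2 : {set H}) :
  @uct_type (lg_union G H) (sum_set S1 S2) =
  union_type (uct_type S1) (uct_type S2).
Proof.
have s0 : (set0 : {set G + H}) = sum_set set0 set0.
  by apply/setP => -[u|u]; rewrite !inE.
have sl u : ([set inl u] : {set G + H}) = sum_set [set u] set0.
  by apply/setP => -[v|v]; rewrite !inE.
have sr u : ([set inr u] : {set G + H}) = sum_set set0 [set u].
  by apply/setP => -[v|v]; rewrite !inE.
rewrite /uct_type /union_type /= [in LHS]s0 trace_type_union; congr pair.
apply/setP => E; rewrite inE; apply/imsetP/orP.
  case=> -[u|u] + ->; rewrite inE => uS.
    by left; rewrite sl trace_type_union; apply/imset_f/imset_f.
  by right; rewrite sr trace_type_union; apply/imset_f/imset_f.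
case=> /imsetP[_ /imsetP[u uS ->] ->].
  by exists (inl u); rewrite ?inE // sl trace_type_union.
by exists (inr u); rewrite ?inE // sr trace_type_union.
Qed.

(** Types see vertices only through membership, label, equality and adjacency, all of which [f]
    preserves. *)
Lemma uct_type_iso G H (f : G -> H) :
  bijective f -> {mono f : u v / adj u v} ->
  (forall v, label (f v) = label v) ->
  forall S : {set G}, uct_type (f @: S) = uct_type S.
Proof.
case=> g fK gK fadj flab S.
have injf := can_inj fK.
have vf (S' X K : {set G}) v : vertex_type (f @: S') (f @: X) (f @: K) (f v) =
    vertex_type S' X K v.
  rewrite /vertex_type !mem_imset // flab; congr pair.
  apply/setP => b; apply/imsetP/imsetP => -[u].
    rewrite inE => /andP[/imsetP[w wK ->]]; rewrite inj_eq // fadj flab => nwv ->.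
    by exists w; rewrite // inE wK.
  rewrite inE => uK ->; exists (f u); rewrite ?flab //.
  by rewrite inE mem_imset // inj_eq // fadj.
have cf (S' X K : {set G}) : clique_type (f @: S') (f @: X) (f @: K) = clique_type S' X K.
  apply/setP => d; apply/imsetP/imsetP => -[v _ ->].
    by exists (g v); rewrite // -{1}(gK v) vf.
  by exists (f v); rewrite ?vf.
have tf (S' X : {set G}) : trace_type (f @: S') (f @: X) = trace_type S' X.
  apply/setP => D; apply/imsetP/imsetP => -[K _ ->].
    exists (g @: K) => //; rewrite -(cf _ _ (g @: K)) -imset_comp.
    by rewrite (eq_imset _ gK) imset_id.
  by exists (f @: K); rewrite ?cf.
congr pair; first by rewrite -[RHS]tf imset0.
rewrite -imset_comp; apply: eq_imset => x /=.
by rewrite -[RHS]tf imset_set1.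
Qed.

End Types.

Lemma minimal_clique_transversal_iso k (G : lgraph k) (H : sgraph) (f : G -> H) :
  bijective f -> {mono f : u v / adj u v} -> forall S : {set G},
  minimal_clique_transversal (f @: S) = minimal_clique_transversal S.
Proof.
move=> bf fadj S; case: (bf) => g fK gK.
(* [H] carries no labels; pulling those of [G] back along the inverse makes [f] label-preserving. *)
pose H' : lgraph k := @LGraph k H (fun v => label (g v)).
rewrite -(@acceptingE k H') -acceptingE; congr accepting.
by apply: (@uct_type_iso _ G H' f) => // v /=; rewrite fK.
Qed.

Lemma upper_clique_transversal_iso k (G : lgraph k) (H : sgraph) l :
  isomorphic G H -> upper_clique_transversal G l <-> upper_clique_transversal H l.
Proof.
case=> f bf fadj; case: (bf) => g fK gK; split=> -[S [mS lS]].
  exists (f @: S); rewrite (minimal_clique_transversal_iso bf) //.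
  by rewrite card_imset //; apply: can_inj fK.
have fgS : f @: (g @: S) = S by rewrite -imset_comp (eq_imset _ gK) imset_id.
exists (g @: S); rewrite -(minimal_clique_transversal_iso bf) // fgS.
by rewrite card_imset //; apply: can_inj gK.
Qed.

(** * Structured programs on the word RAM *)

Section Steps.
Variables (W : nat) (P : program).

(** Unlike [run], this executes exactly [n] instructions and ends in a state, so that executions can
    be composed. *)
Fixpoint steps (n : nat) (s : state) : option state :=
  if n is n'.+1 then
    if step W P s is Some (inl s') then steps n' s' else None
  else Some s.

Lemma steps_add m n s s' s'' :
  steps m s = Some s' -> steps n s' = Some s'' -> steps (m + n) s = Some s''.
Proof.
elim: m s => [|m IHm] s /=; first by case=> ->.
by case: step => // -[] // s1; apply: IHm.
Qed.

Lemma run_steps n T s s' b :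
  steps n s = Some s' -> run W P T s' = Some b -> run W P (n + T) s = Some b.
Proof.
elim: n s => [|n IHn] s /=; first by case=> ->.
by case: step => // -[] // s1; apply: IHn.
Qed.

Lemma step_jump rg mm a r b : onth P a = Some (IJumpZ r b) ->
  step W P (State a rg mm) =
    Some (inl (State (if rg r == 0 then b else a.+1) rg mm)).
Proof. by rewrite /step /= => ->. Qed.

Lemma steps_jump n rg mm a r b s : onth P a = Some (IJumpZ r b) ->
  steps n (State (if rg r == 0 then b else a.+1) rg mm) = s ->
  steps n.+1 (State a rg mm) = s.
Proof. by move=> Pa <-; rewrite /= (step_jump _ _ Pa). Qed.

Lemma run_jump T rg mm a r b x : onth P a = Some (IJumpZ r b) ->
  run W P T (State (if rg r == 0 then b else a.+1) rg mm) = x ->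
  run W P T.+1 (State a rg mm) = x.
Proof. by move=> Pa <-; rewrite /= (step_jump _ _ Pa). Qed.

Lemma run_halt T rg mm a b : onth P a = Some (IHalt b) ->
  run W P T.+1 (State a rg mm) = Some b.
Proof. by move=> Pa; rewrite /= /step /= Pa. Qed.

Lemma run_leq T T' s b :
  T <= T' -> run W P T s = Some b -> run W P T' s = Some b.
Proof.
elim: T T' s => [|T IHT] [|T'] s //=.
by rewrite ltnS => TT'; case: step => // -[s1|//]; apply: IHT.
Qed.

End Steps.

(** Used both for code inside a program and for tokens inside the input. *)
Definition infix_at (A : Type) (s : seq A) (p : nat) (t : seq A) : Prop :=
  exists s1 s2, s = s1 ++ t ++ s2 /\ size s1 = p.

Lemma infix_at_cat A (s : seq A) p t1 t2 :
  infix_at s p (t1 ++ t2) ->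
  infix_at s p t1 /\ infix_at s (p + size t1) t2.
Proof.
case=> s1 [s2 [-> <-]]; rewrite -catA; split; first by exists s1, (t2 ++ s2).
by exists (s1 ++ t1), s2; rewrite -catA size_cat.
Qed.

Lemma infix_at_cons A (s : seq A) p x t :
  infix_at s p (x :: t) -> onth s p = Some x /\ infix_at s p.+1 t.
Proof.
case=> s1 [s2 [-> <-]]; split; first by elim: s1.
by exists (rcons s1 x), s2; rewrite cat_rcons size_rcons.
Qed.

Lemma infix_at_size A (s : seq A) p t : infix_at s p t -> p + size t <= size s.
Proof. by case=> s1 [s2 [-> <-]]; rewrite !size_cat addnA leq_addr. Qed.

Lemma infix_at_nth (s : seq nat) p x t : infix_at s p (x :: t) -> nth 0 s p = x.
Proof. by case=> s1 [s2 [-> <-]]; rewrite nth_cat ltnn subnn. Qed.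

Lemma infix_at_mem (A : eqType) (s : seq A) p x t :
  infix_at s p (x :: t) -> x \in s.
Proof. by case=> s1 [s2 [-> _]]; rewrite mem_cat mem_head orbT. Qed.

Inductive cmd : Type :=
| Skip
| Ins (i : instr)
| Seq (c1 c2 : cmd)
| If (r : nat) (c1 c2 : cmd). (* [c1] if [r = 0], else [c2] *)

(* Register 1 is never written, so it is always 0 and [IJumpZ 1] jumps
   unconditionally. *)
Fixpoint compile (c : cmd) (a : nat) : program :=
  match c with
  | Skip => [::]
  | Ins i => [:: i]
  | Seq c1 c2 => let p1 := compile c1 a in p1 ++ compile c2 (a + size p1)
  | If r c1 c2 =>
      let p2 := compile c2 a.+1 in
      let b := (a.+1 + size p2).+1 in
      let p1 := compile c1 b in
      IJumpZ r b :: p2 ++ IJumpZ 1 (b + size p1) :: p1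
  end.

(** Commands have no loops, so this bound does not depend on the data. Both branches of an [If] are
    charged, and 2 pays for its jumps. *)
Fixpoint cost (c : cmd) : nat :=
  match c with
  | Skip => 0
  | Ins _ => 1
  | Seq c1 c2 => cost c1 + cost c2
  | If _ c1 c2 => (cost c1 + cost c2).+2
  end.

(** * Preconditions of commands, with running time *)

Section Wp.
Variable W : nat.
Implicit Types (rg mm : nat -> nat) (Q : (nat -> nat) -> (nat -> nat) -> Prop).

(** Total correctness with a time bound. The code must sit at the address it was compiled for,
    because jump targets are absolute; keeping register 1 at 0 is part of the contract. *)
Definition wp (c : cmd) rg mm Q : Prop :=
  rg 1 = 0 -> forall P a, infix_at P a (compile c a) ->
  exists n rg' mm',
    [/\ n <= cost c,
        steps W P n (State a rg mm) =
          Some (State (a + size (compile c a)) rg' mm'),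
        rg' 1 = 0 & Q rg' mm'].

Lemma wp_weaken c rg mm Q Q' :
  wp c rg mm Q -> (forall rg' mm', Q rg' mm' -> Q' rg' mm') -> wp c rg mm Q'.
Proof.
move=> wpQ QQ' z P a /(wpQ z) [n [rg' [mm' [? ? ? ?]]]].
by exists n, rg', mm'; split=> //; apply: QQ'.
Qed.

Lemma wp_skip rg mm Q : Q rg mm -> wp Skip rg mm Q.
Proof. by move=> ? z P a _; exists 0, rg, mm; rewrite /= addn0. Qed.

Lemma wp_seq c1 c2 rg mm Q :
  wp c1 rg mm (fun rg' mm' => wp c2 rg' mm' Q) -> wp (Seq c1 c2) rg mm Q.
Proof.
move=> wp1 z P a /= /infix_at_cat[P1 P2].
have [n1 [rg1 [mm1 [le1 st1 z1 wp2]]]] := wp1 z P a P1.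
have [n2 [rg2 [mm2 [le2 st2 z2 Q2]]]] := wp2 z1 P _ P2.
exists (n1 + n2), rg2, mm2; split=> //; first exact: leq_add.
by rewrite size_cat addnA; apply: steps_add st1 st2.
Qed.

Lemma wp_if r c1 c2 rg mm Q :
  (rg r = 0 -> wp c1 rg mm Q) -> (rg r <> 0 -> wp c2 rg mm Q) ->
  wp (If r c1 c2) rg mm Q.
Proof.
move=> wp1 wp2 z P a /= codeP; have [Pa {}codeP] := infix_at_cons codeP.
have [P2 {}codeP] := infix_at_cat codeP; have [Pb P1] := infix_at_cons codeP.
have [r0|/eqP r0] := eqVneq (rg r) 0.
  have [n1 [rg1 [mm1 [le1 st1 z1 Q1]]]] := wp1 r0 z P _ P1.
  exists n1.+1, rg1, mm1; split=> //; first by lia.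
  rewrite [steps _ _ _ _]/= (step_jump _ _ _ Pa) r0 eqxx st1 size_cat /=.
  by congr (Some (State _ _ _)); lia.
have [n2 [rg2 [mm2 [le2 st2 z2 Q2]]]] := wp2 r0 z P _ P2.
(* One instruction for the test, one for the jump over the code of [c1]. *)
exists (n2 + 1).+1, rg2, mm2; split=> //; first by lia.
rewrite [steps _ _ _ _]/= (step_jump _ _ _ Pa); move/eqP/negbTE: r0 => ->.
apply: steps_add st2 _; rewrite /steps (step_jump _ _ _ Pb) z2 eqxx size_cat /=.
by congr (Some (State _ _ _)); lia.
Qed.

Definition upd (f : nat -> nat) (x v : nat) : nat -> nat :=
  [eta f with x |-> v].

Lemma updE f x v y : upd f x v y = if y == x then v else f y.
Proof. by []. Qed.

Lemma upd_eq f x v : upd f x v x = v.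
Proof. by rewrite updE eqxx. Qed.

Lemma upd_neq f x v y : y <> x -> upd f x v y = f y.
Proof. by move/eqP/negbTE; rewrite updE => ->. Qed.

Lemma wp_set_reg i r v rg mm Q :
  (forall P a, onth P a = Some i ->
     step W P (State a rg mm) = set_reg W (State a rg mm) r v) ->
  r <> 1 -> v < W -> Q (upd rg r v) mm -> wp (Ins i) rg mm Q.
Proof.
move=> stepE r1 vW Qv z P a codeP; have [Pa _] := infix_at_cons codeP.
exists 1, (upd rg r v), mm; split=> //.
  by rewrite [steps _ _ _ _]/= (stepE _ _ Pa) /set_reg vW addn1.
by rewrite upd_neq // => /esym.
Qed.

Lemma wp_const r x rg mm Q :
  r <> 1 -> x < W -> Q (upd rg r x) mm -> wp (Ins (IConst r x)) rg mm Q.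
Proof. by move=> r1 xW; apply: wp_set_reg => // P a Pa; rewrite /step /= Pa. Qed.

Lemma wp_add r s t rg mm Q :
  r <> 1 -> rg s + rg t < W -> Q (upd rg r (rg s + rg t)) mm ->
  wp (Ins (IAdd r s t)) rg mm Q.
Proof. by move=> r1 xW; apply: wp_set_reg => // P a Pa; rewrite /step /= Pa. Qed.

Lemma wp_sub r s t rg mm Q :
  r <> 1 -> rg s - rg t < W -> Q (upd rg r (rg s - rg t)) mm ->
  wp (Ins (ISub r s t)) rg mm Q.
Proof. by move=> r1 xW; apply: wp_set_reg => // P a Pa; rewrite /step /= Pa. Qed.

Lemma wp_load r s rg mm Q :
  r <> 1 -> mm (rg s) < W -> Q (upd rg r (mm (rg s))) mm ->
  wp (Ins (ILoad r s)) rg mm Q.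
Proof. by move=> r1 xW; apply: wp_set_reg => // P a Pa; rewrite /step /= Pa. Qed.

Lemma wp_store r s rg mm Q :
  Q rg (upd mm (rg r) (rg s)) -> wp (Ins (IStore r s)) rg mm Q.
Proof.
move=> Qv z P a codeP; have [Pa _] := infix_at_cons codeP.
exists 1, rg, (upd mm (rg r) (rg s)); split=> //.
by rewrite /= /step /= Pa addn1.
Qed.

(** The iteration is unrolled at compile time; [s] is never represented on the machine. *)
Definition for_each (A : Type) (s : seq A) (c : A -> cmd) : cmd :=
  foldr (fun x => Seq (c x)) Skip s.

Lemma wp_for_each A (s : seq A) c (I : seq A -> _) rg mm :
  I [::] rg mm ->
  (forall s1 x s2 rg mm, s = s1 ++ x :: s2 -> I s1 rg mm ->
     wp (c x) rg mm (I (rcons s1 x))) ->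
  wp (for_each s c) rg mm (I s).
Proof.
move=> I0 IS.
suff H s1 s2 : s = s1 ++ s2 -> forall rg mm, I s1 rg mm ->
    wp (for_each s2 c) rg mm (I s) by apply: (H [::]).
elim: s2 s1 => [|x s2 IHs] s1 def_s rg1 mm1 I1 /=.
  by apply: wp_skip; rewrite def_s cats0.
apply/wp_seq/wp_weaken; first exact: IS def_s I1.
by move=> rg2 mm2; apply: IHs; rewrite cat_rcons.
Qed.

(* Needs the constant 1 in register 6. *)
Fixpoint switch (r : nat) (cs : seq cmd) : cmd :=
  if cs is c :: cs' then If r c (Seq (Ins (ISub r r 6)) (switch r cs'))
  else Skip.

Lemma wp_switch r cs rg mm Q :
  r <> 1 -> r <> 6 -> rg 6 = 1 -> rg r < size cs -> rg r <= W ->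
  (forall rg', (forall q, q <> r -> rg' q = rg q) ->
     wp (nth Skip cs (rg r)) rg' mm Q) ->
  wp (switch r cs) rg mm Q.
Proof.
move=> r1 r6; elim: cs rg => //= c cs IHcs rg rg6 lt_r leW wpQ.
apply: wp_if => [r0|r0].
  by have := wpQ rg (fun _ _ => erefl _); rewrite r0.
apply: wp_seq; apply: wp_sub => //; first by lia.
rewrite rg6; apply: IHcs; rewrite ?upd_eq ?upd_neq //; try lia.
move=> rg' Erg'; have -> : rg r - 1 = (rg r).-1 by lia.
have := wpQ rg'; case: (rg r) r0 => // x _ /=; apply.
by move=> q qr; rewrite Erg' // upd_neq.
Qed.

(* [c x] computes [val x] in register 7. *)
Definition maximize (A : Type) (s : seq A) (key : A -> nat) (c : A -> cmd) : cmd :=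
  for_each s (fun x => Seq (c x)
    (Seq (Ins (ISub 8 7 (key x))) (Ins (IAdd (key x) (key x) 8)))).

(** Truncated subtraction followed by addition replaces the target by its maximum with [val x].
    Several [x] may share a target, so the result is described as an upper bound that is attained or
    still the initial content. *)
Lemma wp_maximize (A : eqType) (s : seq A) key c val b rg mm :
  8 < b ->
  {in s, forall x, b <= key x /\ rg (key x) = 0} ->
  {in s, forall x, val x < W} ->
  {in s, forall x rg',
     (forall r, r < b -> r <> 7 -> r <> 8 -> rg' r = rg r) ->
     wp (c x) rg' mm (fun rg2 mm2 => [/\ mm2 = mm, rg2 7 = val x &
       forall r, r <> 7 -> r <> 8 -> rg2 r = rg' r])} ->
  wp (maximize s key c) rg mm (fun rg' mm' =>
    [/\ mm' = mm,
        forall r, r < b -> r <> 7 -> r <> 8 -> rg' r = rg r,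
        {in s, forall x, val x <= rg' (key x)} &
        forall r, b <= r ->
          rg' r = rg r \/ exists2 x, x \in s & key x = r /\ rg' r = val x]).
Proof.
move=> b8 keyb valW wpc.
pose I (s1 : seq A) rg' (mm' : nat -> nat) := [/\ mm' = mm,
        forall r, r < b -> r <> 7 -> r <> 8 -> rg' r = rg r,
        {in s1, forall x, val x <= rg' (key x)} &
        forall r, b <= r ->
          rg' r = rg r \/ exists2 x, x \in s1 & key x = r /\ rg' r = val x].
apply: (@wp_for_each _ s _ I); first by split=> // r _; left.
move=> s1 x s2 rg1 mm1 def_s [-> frame1 lo1 hi1].
have xs : x \in s by rewrite def_s mem_cat mem_head orbT.
have s1s y : y \in s1 -> y \in s by rewrite def_s mem_cat => ->.
have [bx x0] := keyb _ xs; have vx := valW _ xs.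
(* The target holds its initial 0 or the value of an earlier element, so the sum computed below fits
   in a word. *)
have key1W : rg1 (key x) < W.
  case: (hi1 _ bx) => [->|[y ys [_ ->]]]; first by rewrite x0; lia.
  exact/valW/s1s.
apply/wp_seq/wp_weaken; first exact: wpc frame1.
move=> rg2 mm2 [-> v2 frame2].
have k2 : rg2 (key x) = rg1 (key x) by apply: frame2; lia.
apply: wp_seq; apply: wp_sub => //; first by lia.
have k8 : key x <> 8 by lia.
apply: wp_add; rewrite ?upd_eq ?upd_neq // ?v2 ?k2; try lia.
have valx r : upd (upd rg2 8 (val x - rg1 (key x))) (key x)
    (rg1 (key x) + (val x - rg1 (key x))) r =
    if r == key x then maxn (rg1 (key x)) (val x) else
    if r == 8 then val x - rg1 (key x) else rg2 r.
  by rewrite !updE; case: eqP => // _; lia.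
split=> //.
- by move=> r rb r7 r8; rewrite valx ifN_eq ?ifN_eq ?frame2 ?frame1 //; apply/eqP; lia.
- move=> y; rewrite mem_rcons inE valx => /predU1P[->|ys].
    by rewrite eqxx; lia.
  have [by_ _] := keyb _ (s1s _ ys); have := lo1 _ ys.
  case: eqP => [->|_]; first by lia.
  by rewrite ifN_eq ?frame2 //; [lia..|apply/eqP; lia].
move=> r rb; rewrite valx; case: eqP => [->|rx].
  case: (leqP (rg1 (key x)) (val x)) => le.
    right; exists x; rewrite ?mem_rcons ?mem_head //; split=> //; lia.
  case: (hi1 _ bx) => [E|[y ys [Ey E]]]; first by left; lia.
  by right; exists y; rewrite ?mem_rcons ?inE ?ys ?orbT //; split=> //; lia.
rewrite ifN_eq ?frame2; try (try apply/eqP; lia).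
case: (hi1 _ rb) => [|[y ys ?]]; first by left.
by right; exists y; rewrite ?mem_rcons ?inE ?ys ?orbT.
Qed.

End Wp.

(** * Moving tables between registers and the stack *)

Section Blocks.
Variables M W : nat.
Implicit Types (rg mm : nat -> nat).

(** The stack grows upwards in blocks of [M] cells, and register 0 points to its first free cell.
    Registers have static names, so every cell is copied by its own instructions. *)
Definition push (b : nat) : cmd :=
  Seq (for_each (iota 0 M) (fun i => Seq (Ins (IConst 7 i))
        (Seq (Ins (IAdd 7 0 7)) (Ins (IStore 7 (b + i))))))
      (Seq (Ins (IConst 7 M)) (Ins (IAdd 0 0 7))).

Definition pop (b : nat) : cmd :=
  Seq (Ins (IConst 7 M)) (Seq (Ins (ISub 0 0 7))
      (for_each (iota 0 M) (fun i => Seq (Ins (IConst 7 i))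
        (Seq (Ins (IAdd 7 0 7)) (Ins (ILoad (b + i) 7)))))).

Definition clear (b : nat) : cmd :=
  for_each (iota 0 M) (fun i => Ins (IConst (b + i) 0)).

Lemma wp_push b rg mm : 8 < b -> rg 0 + M < W ->
  wp W (push b) rg mm (fun rg' mm' =>
    [/\ rg' 0 = rg 0 + M, forall q, q <> 0 -> q <> 7 -> rg' q = rg q,
        forall i, i < M -> mm' (rg 0 + i) = rg (b + i) &
        forall a, a < rg 0 -> mm' a = mm a]).
Proof.
move=> b8 WM; apply: wp_seq.
pose I (s : seq nat) rg' mm' := [/\ forall q, q <> 7 -> rg' q = rg q,
  forall i, i \in s -> mm' (rg 0 + i) = rg (b + i) &
  forall a, a < rg 0 -> mm' a = mm a].
apply/wp_weaken; first (apply: (@wp_for_each _ _ _ _ I); first by split).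
  move=> s1 x s2 rg1 mm1 def_s [frame new old].
  have: x \in iota 0 M by rewrite def_s mem_cat mem_head orbT.
  rewrite mem_iota add0n /= => xM.
  apply: wp_seq; apply: wp_const => //; first by lia.
  apply: wp_seq; apply: wp_add => //.
    by rewrite upd_eq upd_neq // frame //; lia.
  apply: wp_store; rewrite !upd_eq !upd_neq ?frame; try lia.
  split=> [q q7|i|a a0].
  - by rewrite !upd_neq ?frame.
  - rewrite mem_rcons inE updE eqn_add2l => /predU1P[->|is1].
      by rewrite eqxx.
    by case: eqP => [->//|_]; apply: new.
  - by rewrite upd_neq ?old; lia.
move=> rg1 mm1 [frame new old].
apply: wp_seq; apply: wp_const; [by [] | by lia |].
apply: wp_add; rewrite ?upd_eq ?upd_neq ?frame //.
split=> //; first by move=> q q0 q7; rewrite !upd_neq ?frame.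
by move=> i iM; apply: new; rewrite mem_iota.
Qed.

Lemma wp_pop b rg mm : 8 < b -> M <= rg 0 -> rg 0 < W ->
  (forall i, i < M -> mm (rg 0 - M + i) < W) ->
  wp W (pop b) rg mm (fun rg' mm' =>
    [/\ mm' = mm, rg' 0 = rg 0 - M,
        forall q, q <> 0 -> q <> 7 -> ~~ (b <= q < b + M) -> rg' q = rg q &
        forall i, i < M -> rg' (b + i) = mm (rg 0 - M + i)]).
Proof.
move=> b8 M0 WM mmW.
apply: wp_seq; apply: wp_const; [by [] | by lia |].
apply: wp_seq; apply: wp_sub; rewrite ?upd_eq ?upd_neq //; first by lia.
pose I (s : seq nat) rg' (mm' : nat -> nat) := [/\ mm' = mm, rg' 0 = rg 0 - M,
        forall q, q <> 0 -> q <> 7 -> ~~ (b <= q < b + M) -> rg' q = rg q &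
        forall i, i \in s -> rg' (b + i) = mm (rg 0 - M + i)].
apply/wp_weaken; first (apply: (@wp_for_each _ _ _ _ I); first split=> //).
- by move=> q q0 q7 _; rewrite !upd_neq.
- move=> s1 x s2 rg1 mm1 def_s [-> rg10 frame new].
  have: x \in iota 0 M by rewrite def_s mem_cat mem_head orbT.
  rewrite mem_iota add0n /= => xM.
  apply: wp_seq; apply: wp_const => //; first by lia.
  apply: wp_seq; apply: wp_add => //.
    by rewrite upd_eq upd_neq // rg10; lia.
  apply: wp_load; rewrite ?upd_eq ?upd_neq ?rg10; try lia.
    exact: mmW.
  split=> [//||q q0 q7 qb|i].
  + by rewrite !upd_neq //; lia.
  + by rewrite !upd_neq ?frame //; lia.
  rewrite mem_rcons inE updE eqn_add2l => /predU1P[->|is1].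
    by rewrite eqxx.
  by case: eqP => [->//|_]; rewrite !upd_neq ?new; lia.
move=> rg1 mm1 [-> rg10 frame new]; split=> //.
by move=> i iM; apply: new; rewrite mem_iota.
Qed.

Lemma wp_clear b rg mm : 8 < b -> 0 < W ->
  wp W (clear b) rg mm (fun rg' mm' =>
    [/\ mm' = mm, forall i, i < M -> rg' (b + i) = 0 &
        forall q, q < b -> rg' q = rg q]).
Proof.
move=> b8 W0.
pose I (s : seq nat) rg' (mm' : nat -> nat) := [/\ mm' = mm,
  forall i, i \in s -> rg' (b + i) = 0 & forall q, q < b -> rg' q = rg q].
apply/wp_weaken; first (apply: (@wp_for_each _ _ _ _ I); first by split).
  move=> s1 x s2 rg1 mm1 _ [-> new frame].
  apply: wp_const => //; first by lia.
  split=> // [i|q qb]; last by rewrite upd_neq ?frame; lia.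
  rewrite mem_rcons inE updE eqn_add2l => /predU1P[->|is1].
    by rewrite eqxx.
  by case: eqP => // _; apply: new.
move=> rg1 mm1 [-> new frame]; split=> // i iM.
by apply: new; rewrite mem_iota.
Qed.

End Blocks.

(** * Tables of maxima indexed by types *)

Section Tables.
Variables (T : Type) (M : nat) (rank : T -> nat) (W : nat).
Implicit Types (rg mm : nat -> nat).
Hypotheses (rank_lt : forall t, rank t < M) (rank_inj : injective rank).

Definition produce (b : nat) (A : Type) (s : seq A) (key : A -> T)
    (c : A -> cmd) : cmd :=
  Seq (clear M b) (Seq (maximize s (fun x => b + rank (key x)) c) (push M b)).

(** That is, [f t] is the maximum of [val] over the fibre of [key] above [t], with 0 for an empty
    fibre. *)
Definition table_of (A : eqType) (s : seq A) (key : A -> T) (val : A -> nat)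
    (f : T -> nat) : Prop :=
  {in s, forall x, val x <= f (key x)} /\
  (forall t, f t = 0 \/ exists2 x, x \in s & key x = t /\ f t = val x).

Lemma wp_produce b (A : eqType) (s : seq A) key c val rg mm :
  8 < b -> rg 0 + M < W -> {in s, forall x, val x < W} ->
  {in s, forall x rg',
     (forall q, q < b -> q <> 7 -> q <> 8 -> rg' q = rg q) ->
     wp W (c x) rg' mm (fun rg2 mm2 => [/\ mm2 = mm, rg2 7 = val x &
       forall q, q <> 7 -> q <> 8 -> rg2 q = rg' q])} ->
  wp W (produce b s key c) rg mm (fun rg' mm' => exists2 f,
    table_of s key val f &
    [/\ rg' 0 = rg 0 + M,
        forall q, q < b -> q <> 0 -> q <> 7 -> q <> 8 -> rg' q = rg q,
        forall t, mm' (rg 0 + rank t) = f t &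
        forall a, a < rg 0 -> mm' a = mm a]).
Proof.
move=> b8 WM valW wpc; apply: wp_seq.
apply/wp_weaken; first by apply: wp_clear; lia.
move=> rg1 mm1 [-> zero1 frame1]; apply: wp_seq.
apply/wp_weaken; first apply: (@wp_maximize _ _ _ _ _ val b) => //.
- by move=> x xs; split; rewrite ?leq_addr // zero1.
- move=> x xs rg2 frame2; apply: wpc => // q q1 q2 q3.
  by rewrite frame2 ?frame1.
move=> rg2 mm2 [-> frame2 lo2 hi2].
apply/wp_weaken; first apply: wp_push => //; first by rewrite frame2 ?frame1; lia.
have E0 : rg2 0 = rg 0 by rewrite frame2 ?frame1; lia.
move=> rg3 mm3; rewrite E0 => -[rg30 frame3 new3 old3].
exists (fun t => rg2 (b + rank t)).
  split=> // t; have [->|[x xs [Ex ->]]] := hi2 (b + rank t) (leq_addr _ _).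
    by left; apply: zero1.
  by right; exists x => //; split=> //; apply/rank_inj/(addnI Ex).
split=> // [q qb q0 q7 q8|t]; last by apply: new3.
by rewrite frame3 // frame2 // frame1.
Qed.

End Tables.

(** * Evaluation of k-expressions *)

Section Evaluator.
Variable k : nat.
Local Notation T := (stype k).

Definition ntypes : nat := #|{: stype k}|.
Definition rank (t : T) : nat := enum_rank t.
Local Notation M := ntypes.

Lemma rank_lt t : rank t < M.
Proof. exact: ltn_ord. Qed.

Lemma rank_inj : injective rank.
Proof. by move=> t t' /val_inj/enum_rank_inj. Qed.

Lemma rank_surj i : i < M -> exists t, rank t = i.
Proof. by move=> iM; exists (enum_val (Ordinal iM)); rewrite /rank enum_valK. Qed.

(* The value 0 stands for a type that no set has; otherwise the largest size is
   stored plus 1. *)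
Definition table_for (G : lgraph k) (f : T -> nat) : Prop :=
  (forall S : {set G}, #|S| < f (uct_type S)) /\
  (forall t, f t = 0 \/ exists2 S : {set G}, uct_type S = t & f t = #|S|.+1).

Lemma table_for_bound G f t : table_for G f -> f t <= #|G|.+1.
Proof. by case=> _ /(_ t) [-> //|[S _ ->]]; rewrite ltnS max_card. Qed.

Lemma table_for_vertex i f :
  table_of (enum {set unit}) (@uct_type k (lg_single i)) (fun S => #|S|.+1) f ->
  table_for (lg_single i) f.
Proof.
case=> lo hi; split=> [S|t]; first exact: lo (mem_enum _ S).
by have [|[S _ [? ?]]] := hi t; [left | right; exists S].
Qed.

(** Serves join and relabeling, where [e] and [e'] are identities between the subsets of two graphs
    on the same vertices. Since every subset of [H] is some [e S], maximizing over the preimages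
    under [h] is exact. *)
Lemma table_for_unary h (G H : lgraph k) f f'
    (e : {set G} -> {set H}) (e' : {set H} -> {set G}) :
  cancel e' e ->
  (forall S, uct_type (e S) = h (uct_type S)) ->
  (forall S, #|e S| = #|S|) ->
  table_for G f -> table_of (enum {: T}) h f f' -> table_for H f'.
Proof.
move=> e'K eh ce [lo hi] [lo' hi']; split=> [S|t].
  rewrite -(e'K S) eh ce; apply: leq_trans (lo' _ (mem_enum _ _)).
  exact: lo.
have [|[t1 _ [ht1 ->]]] := hi' t; first by left.
have [|[S St1 ->]] := hi t1; first by left.
by right; exists (e S); rewrite ?ce // eh St1.
Qed.

(** Entries are sizes plus 1, so adding two of them counts one unit too many; an absent type on
    either side makes the pair absent. *)
Definition union_value (f1 f2 : T -> nat) (p : T * T) : nat :=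
  if (f1 p.1 == 0) || (f2 p.2 == 0) then 0 else f1 p.1 + f2 p.2 - 1.

(** The two halves of a set are chosen independently and their sizes add, so for a fixed pair of
    types the maximum is the sum of the maxima. *)
Lemma table_for_union G H f1 f2 f :
  table_for G f1 -> table_for H f2 ->
  table_of (enum {: T * T}) (fun p => union_type p.1 p.2) (union_value f1 f2) f ->
  table_for (lg_union G H) f.
Proof.
move=> [lo1 hi1] [lo2 hi2] [lo hi]; split=> [S|t].
  rewrite (sum_setE S) uct_type_union card_sum_set.
  set S1 := _ @^-1: _; set S2 := inr @^-1: _.
  have := lo (uct_type S1, uct_type S2) (mem_enum _ _).
  by rewrite /union_value /=; have := lo1 S1; have := lo2 S2; case: eqP; case: eqP => /=; lia.
have [|[[t1 t2] _ [/= <- ->]]] := hi t; first by left.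
rewrite /union_value /=.
have [-> |[S1 E1 F1]] := hi1 t1; first by left.
have [-> |[S2 E2 F2]] := hi2 t2; first by left; rewrite orbT.
right; exists (sum_set S1 S2); first by rewrite uct_type_union E1 E2.
by rewrite card_sum_set F1 F2 /=; lia.
Qed.

(* Register 0 is the stack pointer, 2 the input pointer, 3 the number of words of
   the expression left to read, 6 the constant 1, and 4, 5, 7, 8 are scratch.  Two
   operand tables start at registers 9 and [9 + M], the result at [regs_C]. *)
Definition regs_C : nat := 9 + M + M.

Definition move (r q : nat) : cmd := Seq (Ins (IConst r 0)) (Ins (IAdd r r q)).

(** The two subsets of a one-vertex graph and their types are worked out when the program is built;
    only constants are loaded at run time. *)
Definition op_vertex (i : 'I_k) : cmd :=
  produce M rank regs_C (enum {set unit}) (@uct_type k (lg_single i))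
    (fun S => Ins (IConst 7 #|S|.+1)).

Definition op_unary (h : T -> T) : cmd :=
  Seq (pop M 9)
      (produce M rank regs_C (enum {: T}) h (fun t => move 7 (9 + rank t))).

(** The right operand was pushed last, so it is popped first, into the second operand area. *)
Definition op_union : cmd :=
  Seq (pop M (9 + M)) (Seq (pop M 9)
      (produce M rank regs_C (enum {: T * T}) (fun p => union_type p.1 p.2)
        (fun p => Seq (Ins (IConst 7 0))
          (If (9 + rank p.1) Skip (If (9 + M + rank p.2) Skip
             (Seq (Ins (IAdd 7 (9 + rank p.1) (9 + M + rank p.2)))
                  (Ins (ISub 7 7 6)))))))).

Definition fetch (r : nat) : cmd :=
  Seq (Ins (ILoad r 2)) (Seq (Ins (IAdd 2 2 6)) (Ins (ISub 3 3 6))).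

(** Turns a label read at run time into a compile-time parameter: the code is duplicated for each of
    the [k] labels. *)
Definition label_case (r : nat) (c : 'I_k -> cmd) : cmd :=
  switch r [seq c i | i <- enum 'I_k].

Definition unary_case (h : 'I_k -> 'I_k -> T -> T) : cmd :=
  Seq (fetch 4) (Seq (fetch 5)
    (label_case 4 (fun i => label_case 5 (fun j => op_unary (h i j))))).

(** The positions are the opcodes 0 to 3 used by [kexpr_code]. *)
Definition token_cases : seq cmd :=
  [:: Seq (fetch 4) (label_case 4 op_vertex);
      op_union;
      unary_case (fun i j => map_type (join_vtype i j));
      unary_case (fun i j => map_type (relabel_vtype i j))].

Definition token : cmd := Seq (fetch 4) (switch 4 token_cases).

Variables (W : nat) (w : seq nat).
Implicit Types (rg mm : nat -> nat) (D : seq (T -> nat)).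
Hypotheses (words : {in w, forall x, x < W}) (sizeW : size w + 8 < W)
  (roomW : size w + M * size w + M < W).

(** The stack lies directly behind the input, which therefore stays intact; the head of [D] is the
    top. *)
Fixpoint stack_at mm D : Prop :=
  if D is f :: D' then
    (forall t, mm (size w + M * size D' + rank t) = f t) /\ stack_at mm D'
  else True.

(* [p] is the address of the next token, [l] the number of words of the
   expression that remain to be read, and [D] the stack of tables. *)
Definition config rg mm (p l : nat) D : Prop :=
  [/\ rg 0 = size w + M * size D, rg 6 = 1, rg 2 = p, rg 3 = l &
      (forall a, a < size w -> mm a = nth 0 w a) /\ stack_at mm D].

Lemma stack_at_frame mm mm' D :
  (forall a, a < size w + M * size D -> mm' a = mm a) ->
  stack_at mm D -> stack_at mm' D.
Proof.
elim: D => //= f D IHD frame [mf mD]; split=> [t|].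
  rewrite frame ?mf //; have := rank_lt t; lia.
by apply: IHD mD => a aD; apply: frame; lia.
Qed.

Lemma config_frame rg rg' mm p l D :
  (forall q, q \in [:: 0; 2; 3; 6] -> rg' q = rg q) ->
  config rg mm p l D -> config rg' mm p l D.
Proof. by move=> E; rewrite /config !E. Qed.

Lemma wp_produce_config (A : eqType) (s : seq A) key c val rg mm p l D :
  config rg mm p l D -> size D < size w ->
  {in s, forall x, val x < W} ->
  {in s, forall x rg',
     (forall q, q < regs_C -> q <> 7 -> q <> 8 -> rg' q = rg q) ->
     wp W (c x) rg' mm (fun rg2 mm2 => [/\ mm2 = mm, rg2 7 = val x &
       forall q, q <> 7 -> q <> 8 -> rg2 q = rg' q])} ->
  wp W (produce M rank regs_C s key c) rg mm (fun rg' mm' => exists2 f,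
    table_of s key val f & config rg' mm' p l (f :: D)).
Proof.
move=> [r0 r6 r2 r3 [mw mD]] sD valW wpc.
have room : M * (size D).+1 <= M * size w by rewrite leq_mul2l sD orbT.
have C9 : 8 < regs_C by rewrite /regs_C; lia.
apply/wp_weaken; first by apply: (wp_produce rank_lt rank_inj) valW wpc => //; lia.
move=> rg' mm' [f tf [r0' frame new old]]; exists f => //.
split; rewrite /= ?r0' ?frame //; try lia.
split=> [a aw|]; first by rewrite old ?mw //; lia.
split=> [t|]; first by rewrite -new r0.
by apply: stack_at_frame mD => a aD; rewrite old // r0.
Qed.

Lemma wp_op_vertex i rg mm p l D :
  config rg mm p l D -> size D < size w ->
  wp W (op_vertex i) rg mm (fun rg' mm' => exists2 f,
    table_for (lg_single i) f & config rg' mm' p l (f :: D)).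
Proof.
move=> cfg sD.
have card2 (S : {set unit}) : #|S|.+1 < W.
  by have := max_card S; rewrite card_unit; lia.
apply/wp_weaken.
  apply: (@wp_produce_config {set unit} _ _ _ (fun S => #|S|.+1) _ _ _ _ _ cfg) => //.
  move=> S _ rg' frame; apply: wp_const => //; split=> // q q7 _.
  by rewrite upd_neq.
by move=> rg' mm' [f /table_for_vertex]; exists f.
Qed.

Lemma wp_pop_config b rg mm p l f D :
  8 < b -> config rg mm p l (f :: D) -> size D < size w ->
  (forall t, f t < W) ->
  wp W (pop M b) rg mm (fun rg' mm' =>
    [/\ mm' = mm, config rg' mm p l D, forall t, rg' (b + rank t) = f t &
        forall q, q <> 0 -> q <> 7 -> ~~ (b <= q < b + M) -> rg' q = rg q]).
Proof.
move=> b8 [r0 r6 r2 r3 [mw [mf mD]]] sD fW.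
have room : M * (size D).+1 <= M * size w by rewrite leq_mul2l sD orbT.
move: r0 => /= r0.
have top : rg 0 - M = size w + M * size D by lia.
apply/wp_weaken; first apply: wp_pop => //; try lia.
  by move=> i /rank_surj[t <-]; rewrite top mf.
move=> rg' mm' [-> r0' frame new]; split=> //.
  by split; rewrite ?r0' ?frame //; lia.
by move=> t; rewrite new ?rank_lt // top mf.
Qed.

Lemma wp_op_unary h rg mm p l f D :
  config rg mm p l (f :: D) -> size D < size w -> (forall t, f t < W) ->
  wp W (op_unary h) rg mm (fun rg' mm' => exists2 f',
    table_of (enum {: T}) h f f' & config rg' mm' p l (f' :: D)).
Proof.
move=> cfg sD fW; apply: wp_seq.
apply/wp_weaken; first exact: (wp_pop_config _ cfg).
move=> rg1 mm1 [-> cfg1 A1 _].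
apply: (wp_produce_config cfg1) => // t _ rg2 frame.
have tM := rank_lt t.
have At : rg2 (9 + rank t) = f t by rewrite frame ?A1 // /regs_C; lia.
apply: wp_seq; apply: wp_const => //; first by lia.
have sum7 : upd rg2 7 0 7 + upd rg2 7 0 (9 + rank t) = f t.
  by rewrite upd_eq upd_neq ?At.
apply: wp_add => //; first by rewrite sum7.
split=> // q q7 _; rewrite !upd_neq //.
Qed.

Lemma wp_op_union rg mm p l f1 f2 D :
  config rg mm p l (f2 :: f1 :: D) -> (size D).+1 < size w ->
  (forall t t', f1 t + f2 t' < W) ->
  wp W op_union rg mm (fun rg' mm' => exists2 f,
    table_of (enum {: T * T}) (fun p => union_type p.1 p.2)
      (union_value f1 f2) f & config rg' mm' p l (f :: D)).
Proof.
move=> cfg sD fW.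
have f1W t : f1 t < W by have := fW t t; lia.
have f2W t : f2 t < W by have := fW t t; lia.
apply: wp_seq; apply/wp_weaken; first by apply: (wp_pop_config _ cfg) => //; lia.
move=> rg1 mm1 [-> cfg1 B1 _].
apply: wp_seq; apply/wp_weaken; first by apply: (wp_pop_config _ cfg1) => //; lia.
move=> rg2 mm2 [-> cfg2 A2 frame2].
apply: (wp_produce_config cfg2) => //; first by lia.
  move=> [t t'] _; rewrite /union_value /=; case: ifP => _; first by lia.
  by have := fW t t'; lia.
move=> [t t'] _ rg3 frame3; have [_ r6 _ _ _] := cfg2.
have tM := rank_lt t; have tM' := rank_lt t'.
have At : rg3 (9 + rank t) = f1 t by rewrite frame3 ?A2 // /regs_C; lia.
have Bt : rg3 (9 + M + rank t') = f2 t'.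
  by rewrite frame3 ?frame2 ?B1 // /regs_C; lia.
have r6' : rg3 6 = 1 by rewrite frame3 // /regs_C; lia.
apply: wp_seq; apply: wp_const => //; first by lia.
rewrite /union_value /=; apply: wp_if; rewrite upd_neq ?At; try lia.
  move=> ->; apply: wp_skip; split=> // q ? ?; rewrite upd_neq //.
move=> f1t; apply: wp_if; rewrite upd_neq ?Bt; try lia.
  move=> ->; apply: wp_skip; split=> // [|q ? ?]; [by rewrite upd_eq orbT | by rewrite upd_neq].
move=> f2t; apply: wp_seq.
have sum7 : upd rg3 7 0 (9 + rank t) + upd rg3 7 0 (9 + M + rank t') = f1 t + f2 t'.
  by rewrite !upd_neq ?At ?Bt //; lia.
apply: wp_add => //; rewrite sum7 //.
have one6 : upd (upd rg3 7 0) 7 (f1 t + f2 t') 6 = 1 by rewrite !upd_neq.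
apply: wp_sub => //; rewrite upd_eq one6; first by have := fW t t'; lia.
split=> // [|q ? ?]; last by rewrite !upd_neq.
by rewrite upd_eq; case: eqP => //; case: eqP.
Qed.

Lemma wp_fetch r rg mm p x s D :
  r \notin [:: 0; 1; 2; 3; 6] -> infix_at w p (x :: s) ->
  config rg mm p (size s).+1 D ->
  wp W (fetch r) rg mm (fun rg' mm' =>
    [/\ mm' = mm, rg' r = x, config rg' mm p.+1 (size s) D &
        forall q, q \notin [:: 2; 3; r] -> rg' q = rg q]).
Proof.
rewrite !inE => rN wpx [r0 r6 r2 r3 [mw mD]].
have [ps xW] : p + size s < size w /\ x < W.
  have := infix_at_size wpx; rewrite /= => ?; split; first by lia.
  exact/words/infix_at_mem/wpx.
have mp : mm p = x by rewrite mw ?(infix_at_nth wpx) //; lia.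
apply: wp_seq; apply: wp_load; rewrite ?r2 ?mp; try lia.
apply: wp_seq; apply: wp_add; rewrite ?(@upd_neq _ _ _ 2) ?(@upd_neq _ _ _ 6) ?r2 ?r6; try lia.
apply: wp_sub; rewrite ?(@upd_neq _ _ _ 3) ?(@upd_neq _ _ _ 6) ?r3 ?r6; try lia.
split=> //; first by rewrite !updE eqxx; do 2!(case: eqP; first by lia).
  split=> //.
  - by rewrite !upd_neq ?r0; lia.
  - by rewrite !upd_neq ?r6; lia.
  - by rewrite upd_neq // upd_eq addn1.
  - by rewrite upd_eq subn1.
by move=> q; rewrite !inE !negb_or => /and3P[/eqP q2 /eqP q3 /eqP qr]; rewrite !upd_neq.
Qed.

Lemma wp_label_case r c (i : 'I_k) rg mm Q :
  r <> 1 -> r <> 6 -> rg 6 = 1 -> rg r = i -> i < W ->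
  (forall rg', (forall q, q <> r -> rg' q = rg q) -> wp W (c i) rg' mm Q) ->
  wp W (label_case r c) rg mm Q.
Proof.
move=> r1 r6 rg6 rgr iW wpc; apply: wp_switch => //.
- by rewrite size_map size_enum_ord rgr.
- by rewrite rgr ltnW.
by move=> rg' /wpc; rewrite rgr (nth_map i) ?size_enum_ord // nth_ord_enum.
Qed.

Lemma wp_token_case x s rg mm p D Q :
  x < 4 -> infix_at w p (x :: s) -> config rg mm p (size s).+1 D ->
  (forall rg', config rg' mm p.+1 (size s) D ->
    wp W (nth Skip token_cases x) rg' mm Q) ->
  wp W token rg mm Q.
Proof.
move=> x4 wpx cfg wpQ; apply/wp_seq/wp_weaken; first exact: (wp_fetch _ wpx cfg).
move=> rg1 mm1 [-> r4 cfg1 _]; have [_ r6 _ _ _] := cfg1.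
apply: wp_switch; rewrite ?r4 //; first by lia.
move=> rg2 frame2; apply: wpQ; apply: (config_frame _ cfg1) => q.
by rewrite !inE => /or4P[] /eqP->; apply: frame2.
Qed.

Lemma wp_token_vertex i s rg mm p D :
  infix_at w p [:: 0, val i & s] -> config rg mm p (size s).+2 D ->
  size D < size w ->
  wp W token rg mm (fun rg' mm' => exists2 f,
    table_for (lg_single i) f & config rg' mm' (p + 2) (size s) (f :: D)).
Proof.
move=> wpx cfg sD; apply: (wp_token_case _ wpx cfg) => // rg1 cfg1.
have [_ wpi] := infix_at_cons wpx.
have iW : i < W by exact/words/infix_at_mem/wpi.
apply/wp_seq/wp_weaken; first exact: (wp_fetch _ wpi cfg1).
move=> rg2 mm2 [-> r4 cfg2 _]; have [_ r6 _ _ _] := cfg2.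
apply: (wp_label_case _ _ r6 r4 iW) => // rg3 frame3.
rewrite addn2; apply: wp_op_vertex sD; apply: (config_frame _ cfg2) => q.
by rewrite !inE => /or4P[] /eqP->; apply: frame3.
Qed.

Lemma wp_token_union s rg mm p f1 f2 D :
  infix_at w p (1 :: s) -> config rg mm p (size s).+1 (f2 :: f1 :: D) ->
  (size D).+1 < size w -> (forall t t', f1 t + f2 t' < W) ->
  wp W token rg mm (fun rg' mm' => exists2 f,
    table_of (enum {: T * T}) (fun p => union_type p.1 p.2)
      (union_value f1 f2) f & config rg' mm' (p + 1) (size s) (f :: D)).
Proof.
move=> wpx cfg sD fW; apply: (wp_token_case _ wpx cfg) => // rg1 cfg1.
by rewrite addn1; apply: wp_op_union.
Qed.

Lemma wp_token_unary x (h : 'I_k -> 'I_k -> T -> T) (i j : 'I_k) s rg mm p f D :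
  ((x = 2) /\ h = fun i j => map_type (join_vtype i j)) \/
  ((x = 3) /\ h = fun i j => map_type (relabel_vtype i j)) ->
  infix_at w p [:: x, val i, val j & s] -> config rg mm p (size s).+3 (f :: D) ->
  size D < size w -> (forall t, f t < W) ->
  wp W token rg mm (fun rg' mm' => exists2 f',
    table_of (enum {: T}) (h i j) f f' &
    config rg' mm' (p + 3) (size s) (f' :: D)).
Proof.
move=> xh wpx cfg sD fW.
apply: (wp_token_case _ wpx cfg); first by case: xh => -[-> _].
move=> rg1 cfg1.
suff : wp W (unary_case h) rg1 mm (fun rg' mm' => exists2 f',
    table_of (enum {: T}) (h i j) f f' &
    config rg' mm' (p + 3) (size s) (f' :: D)) by case: xh => -[-> ->].
have [_ wpi] := infix_at_cons wpx; have [_ wpj] := infix_at_cons wpi.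
have iW : i < W by exact/words/infix_at_mem/wpi.
have jW : j < W by exact/words/infix_at_mem/wpj.
apply/wp_seq/wp_weaken; first exact: (wp_fetch _ wpi cfg1).
move=> rg2 mm2 [-> r4 cfg2 _].
apply/wp_seq/wp_weaken; first exact: (wp_fetch _ wpj cfg2).
move=> rg3 mm3 [-> r5 cfg3 frame3]; have [_ r6 _ _ _] := cfg3.
rewrite -frame3 // in r4.
apply: (wp_label_case _ _ r6 r4 iW) => // rg4 frame4.
rewrite -frame4 // in r5; rewrite -frame4 // in r6.
apply: (wp_label_case _ _ r6 r5 jW) => // rg5 frame5.
rewrite addn3; apply: wp_op_unary sD fW; apply: (config_frame _ cfg3) => q.
by rewrite !inE => /or4P[] /eqP->; rewrite frame5 ?frame4.
Qed.

End Evaluator.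

(** * The complete program: prologue, evaluation loop, decision *)

Section Program.
Variable k : nat.
Local Notation T := (stype k).
Local Notation M := (ntypes k).

(* An instance starts with the two words of the bound and the length of the
   expression, whose code thus begins at address 3. *)
Definition prologue : cmd :=
  Seq (Ins (IConst 6 1)) (Seq (Ins (IConst 2 2)) (Seq (Ins (ILoad 3 2))
      (Ins (IConst 2 3)))).

(* Leaves the largest entry of the final table at an accepting type, minus the
   bound (or 0 if that is negative), in register 4. *)
Definition epilogue : cmd :=
  Seq (pop M 9)
  (Seq (Ins (IConst (regs_C k) 0))
  (Seq (maximize [seq t <- enum {: T} | accepting t] (fun=> regs_C k)
          (fun t => move 7 (9 + rank t)))
  (Seq (Ins (IConst 5 0))
  (Seq (Ins (ILoad 4 5))
  (Seq (If 4 (Seq (Ins (IConst 5 1)) (Ins (ILoad 5 5))) Skip)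
       (Ins (ISub 4 (regs_C k) 5))))))).

Definition loop_start : nat := size (compile prologue 0).
Definition body : program := compile (token k) loop_start.+1.
Definition loop_end : nat := (loop_start.+1 + size body).+1.
Definition finish : program := compile epilogue loop_end.

(** The only loop: [body] is repeated until register 3, the number of unread words of the
    expression, is 0. The last test rejects iff register 4 is 0. *)
Definition uct_program : program :=
  compile prologue 0 ++ IJumpZ 3 loop_end :: body ++ IJumpZ 1 loop_start ::
  finish ++ [:: IJumpZ 4 (loop_end + size finish).+2; IHalt true; IHalt false].

Lemma uct_program_code :
  [/\ infix_at uct_program 0 (compile prologue 0),
      onth uct_program loop_start = Some (IJumpZ 3 loop_end),
      infix_at uct_program loop_start.+1 body,
      onth uct_program (loop_start.+1 + size body) = Some (IJumpZ 1 loop_start) &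
      infix_at uct_program loop_end (finish ++
        [:: IJumpZ 4 (loop_end + size finish).+2; IHalt true; IHalt false])].
Proof.
have code0 : infix_at uct_program 0 uct_program.
  by exists [::], [::]; rewrite cats0.
have [pro code1] := infix_at_cat code0; rewrite add0n in code1.
have [jmp code2] := infix_at_cons code1.
have [bod code3] := infix_at_cat code2.
by have [back code4] := infix_at_cons code3.
Qed.

Variables (W : nat) (w : seq nat).
Hypotheses (words : {in w, forall x, x < W}) (sizeW : size w + 8 < W)
  (roomW : size w + M * size w + M < W).

(** The two extra instructions are the loop test and the jump back. *)
Lemma iteration rg mm Q :
  rg 1 = 0 -> rg 3 <> 0 -> wp W (token k) rg mm Q ->
  exists n rg' mm',
    [/\ n <= (cost (token k)).+2,
        steps W uct_program n (State loop_start rg mm) =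
          Some (State loop_start rg' mm'),
        rg' 1 = 0 & Q rg' mm'].
Proof.
move=> z /eqP/negbTE r3 /(_ z); have [_ start bod back _] := uct_program_code.
case/(_ _ _ bod) => n [rg' [mm' [le st z' Q']]].
exists (n + 1).+1, rg', mm'; split=> //; first by rewrite addn1 !ltnS.
apply: steps_jump start _; rewrite r3; apply: steps_add st _.
by apply: steps_jump back _; rewrite z'.
Qed.

(** Keeps table entries, which are at most the number of vertices plus 1, within the input length,
    hence within a word. It also shows that codes are nonempty. *)
Lemma card_kgraph_code (t : kexpr k) : #|kgraph t| < size (kexpr_code t).
Proof.
elim: t => [i|t1 IH1 t2 IH2|i j ij t IH|i j ij t IH] /=; rewrite ?size_cat //=.
- by rewrite card_unit.
- by rewrite card_sum; lia.
- exact: leq_trans IH (leq_addr _ _).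
- exact: leq_trans IH (leq_addr _ _).
Qed.

(** Reading the postfix code of [t] pushes one table, whatever rest [s] follows and whatever stack
    [D] lies below; this generality is what the induction needs. The bound on [size D] guarantees
    room for the stack. *)
Lemma evaluation (t : kexpr k) s rg mm p D :
  infix_at w p (kexpr_code t ++ s) ->
  config w rg mm p (size (kexpr_code t ++ s)) D -> rg 1 = 0 ->
  size D + size (kexpr_code t) <= size w ->
  exists n rg' mm',
    [/\ n <= (cost (token k)).+2 * size (kexpr_code t),
        steps W uct_program n (State loop_start rg mm) =
          Some (State loop_start rg' mm'),
        rg' 1 = 0 &
        exists2 f, table_for (kgraph t) f &
          config w rg' mm' (p + size (kexpr_code t)) (size s) (f :: D)].
Proof.
elim: t s rg mm p D => [i|t1 IH1 t2 IH2|i j ij t IH|i j ij t IH] s rg mm p D /=.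
- move=> wp_ cfg z sD; have [_ _ _ r3 _] := cfg.
  have [||n [rg' [mm' [le st z' Q]]]] :=
    iteration z _ (wp_token_vertex words sizeW roomW wp_ cfg _).
  + by rewrite r3.
  + by lia.
  by exists n, rg', mm'; split=> //; exact: leq_trans le (leq_pmulr _ _).
- rewrite -!catA !size_cat /= => wp1 cfg1 z1 sD.
  have {}cfg1 : config w rg mm p
      (size (kexpr_code t1 ++ kexpr_code t2 ++ 1 :: s)) D by rewrite !size_cat.
  have sD1 : size D + size (kexpr_code t1) <= size w by lia.
  have [n1 [rg1 [mm1 [le1 st1 z2 [f1 tf1 cfg2]]]]] := IH1 _ _ _ _ _ wp1 cfg1 z1 sD1.
  have [_ wp2] := infix_at_cat wp1.
  (* The extra stack entry is paid for by the nonempty code of [t1]. *)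
  have sD2 : size (f1 :: D) + size (kexpr_code t2) <= size w.
    by rewrite /=; have := card_kgraph_code t1; lia.
  have [n2 [rg2 [mm2 [le2 st2 z3 [f2 tf2 cfg3]]]]] := IH2 _ _ _ _ _ wp2 cfg2 z2 sD2.
  have [_ wp3] := infix_at_cat wp2; have [_ _ _ r3 _] := cfg3.
  have c1 := card_kgraph_code t1; have c2 := card_kgraph_code t2.
  have [|||n3 [rg3 [mm3 [le3 st3 z4 [f tf cfg4]]]]] :=
      iteration z3 _ (wp_token_union words sizeW roomW wp3 cfg3 _ _).
  + by rewrite r3.
  + by lia.
  + move=> x y; have := table_for_bound x tf1; have := table_for_bound y tf2; lia.
  exists (n1 + (n2 + n3)), rg3, mm3; split=> //.
  + by rewrite !mulnDr muln1 !leq_add.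
  + by apply: steps_add st1 _; apply: steps_add st2 _.
  exists f; first exact: table_for_union tf1 tf2 tf.
  by rewrite !addnA.
- rewrite -!catA !size_cat /= => wp1 cfg1 z1 sD.
  have {}cfg1 : config w rg mm p
      (size (kexpr_code t ++ [:: 2, val i, val j & s])) D by rewrite size_cat.
  have sD1 : size D + size (kexpr_code t) <= size w by lia.
  have [n1 [rg1 [mm1 [le1 st1 z2 [f1 tf1 cfg2]]]]] := IH _ _ _ _ _ wp1 cfg1 z1 sD1.
  have [_ wp2] := infix_at_cat wp1; have [_ _ _ r3 _] := cfg2.
  have c1 := card_kgraph_code t.
  have [||||n2 [rg2 [mm2 [le2 st2 z3 [f tf cfg3]]]]] :=
    iteration z2 _ (wp_token_unary words sizeW roomW
      (h := fun i j => map_type (join_vtype i j)) _ wp2 cfg2 _ _).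
  + by rewrite r3.
  + by left.
  + by lia.
  + by move=> x; have := table_for_bound x tf1; lia.
  exists (n1 + n2), rg2, mm2; split=> //.
  + by rewrite mulnDr leq_add // (leq_trans le2) ?leq_pmulr.
  + by apply: steps_add st1 st2.
  exists f; last by rewrite addnA.
  (* A join keeps the vertices, so the correspondence of subsets is the identity. *)
  apply: (@table_for_unary k _ (kgraph t) (lg_join ij (kgraph t)) _ _ id id) tf1 tf => // S.
  exact: uct_type_join.
- rewrite -!catA !size_cat /= => wp1 cfg1 z1 sD.
  have {}cfg1 : config w rg mm p
      (size (kexpr_code t ++ [:: 3, val i, val j & s])) D by rewrite size_cat.
  have sD1 : size D + size (kexpr_code t) <= size w by lia.
  have [n1 [rg1 [mm1 [le1 st1 z2 [f1 tf1 cfg2]]]]] := IH _ _ _ _ _ wp1 cfg1 z1 sD1.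
  have [_ wp2] := infix_at_cat wp1; have [_ _ _ r3 _] := cfg2.
  have c1 := card_kgraph_code t.
  have [||||n2 [rg2 [mm2 [le2 st2 z3 [f tf cfg3]]]]] :=
    iteration z2 _ (wp_token_unary words sizeW roomW
      (h := fun i j => map_type (relabel_vtype i j)) _ wp2 cfg2 _ _).
  + by rewrite r3.
  + by right.
  + by lia.
  + by move=> x; have := table_for_bound x tf1; lia.
  exists (n1 + n2), rg2, mm2; split=> //.
  + by rewrite mulnDr leq_add // (leq_trans le2) ?leq_pmulr.
  + by apply: steps_add st1 st2.
  exists f; last by rewrite addnA.
  apply: (@table_for_unary k _ (kgraph t) (lg_relabel i j (kgraph t)) _ _ id id) tf1 tf => // S.
  exact: uct_type_relabel.
Qed.

(** Words 0 and 1 hold the sign and the absolute value of the bound. Entries are sizes plus 1, so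
    the difference with the bound is nonzero iff some size reaches it; a negative bound becomes the
    threshold 0, passed by every type that occurs. *)
Lemma wp_epilogue rg mm p l (f : T -> nat) :
  config w rg mm p l [:: f] -> 1 < size w -> (forall t, f t < W) ->
  wp W epilogue rg mm (fun rg' _ =>
    rg' 4 <> 0 <-> exists2 t, accepting t &
      (if nth 0 w 0 == 0 then nth 0 w 1 else 0) < f t).
Proof.
move=> cfg sw fW; apply: wp_seq.
apply/wp_weaken; first by apply: (wp_pop_config sizeW roomW _ cfg) => //=; lia.
move=> rg1 mm1 [-> [_ _ _ _ [mw _]] A1 _] {cfg}.
have C9 : 8 < regs_C k by rewrite /regs_C; lia.
have w0W : nth 0 w 0 < W by exact/words/mem_nth/ltnW.
have w1W : nth 0 w 1 < W by exact/words/mem_nth.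
apply: wp_seq; apply: wp_const; [lia..|].
apply/wp_seq/wp_weaken.
  apply: (@wp_maximize W {: T} _ _ _ f (regs_C k)) => //.
  - by move=> t _; rewrite upd_eq.
  - move=> t _ rg2 frame2; have tM := rank_lt t.
    have At : rg2 (9 + rank t) = f t.
      by rewrite frame2 ?upd_neq ?A1 // /regs_C; lia.
    apply: wp_seq; apply: wp_const => //; first by lia.
    have sum7 : upd rg2 7 0 7 + upd rg2 7 0 (9 + rank t) = f t.
      by rewrite upd_eq upd_neq ?At.
    apply: wp_add => //; first by rewrite sum7.
    by split=> // q q7 _; rewrite !upd_neq.
move=> rg2 mm2 [-> _ lo hi].
(* All accepting types share one target register, which thus holds the maximum over them. *)
have {lo hi} maxC b : b < rg2 (regs_C k) <-> exists2 t, accepting t & b < f t.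
  split=> [b_lt|[t acc bt]]; last first.
    by apply: leq_trans bt (lo t _); rewrite mem_filter acc mem_enum.
  case: (hi _ (leqnn _)) => [E|[t + [_ E]]].
    by rewrite E upd_eq in b_lt.
  by rewrite mem_filter => /andP[acc _]; exists t; rewrite // -E.
have CW : rg2 (regs_C k) < W.
  case E : (rg2 (regs_C k)) => [|b]; first by lia.
  have [|t _ bt] := (maxC b).1; first by rewrite E.
  exact: leq_trans (fW t).
apply: wp_seq; apply: wp_const => //; first by lia.
apply: wp_seq; apply: wp_load; rewrite ?upd_eq ?mw; try lia.
set rg3 := upd _ 4 _.
have r34 : rg3 4 = nth 0 w 0 by rewrite /rg3 upd_eq.
have r35 : rg3 5 = 0 by rewrite /rg3 upd_neq // upd_eq.
have r3C : rg3 (regs_C k) = rg2 (regs_C k) by rewrite /rg3 !upd_neq; lia.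
apply: wp_seq; apply: wp_if; rewrite r34 => w0.
  rewrite w0 eqxx; apply: wp_seq; apply: wp_const => //; first by lia.
  apply: wp_load; rewrite ?upd_eq ?mw //.
  have diff : upd (upd rg3 5 1) 5 (nth 0 w 1) (regs_C k) -
      upd (upd rg3 5 1) 5 (nth 0 w 1) 5 = rg2 (regs_C k) - nth 0 w 1.
    by rewrite upd_eq !upd_neq ?r3C //; lia.
  apply: wp_sub => //; rewrite diff; first by lia.
  by rewrite upd_eq -maxC; lia.
(* Register 5 still holds 0, the address of the sign, and this serves as the threshold. *)
move/eqP/negbTE: w0 => ->; apply: wp_skip.
apply: wp_sub => //; rewrite r35 r3C; first by lia.
by rewrite upd_eq -maxC; lia.
Qed.

Lemma wp_prologue (e : kexpr k) l g :
  w = int_code l ++ (size (kexpr_code e) :: kexpr_code e) ++ g ->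
  wp W prologue (register (init w)) (memory (init w)) (fun rg' mm' =>
    config (k := k) w rg' mm' 3 (size (kexpr_code e)) [::]).
Proof.
move=> def_w; have nW : size (kexpr_code e) < W.
  by apply: words; rewrite def_w !(mem_cat, inE) eqxx !orbT.
apply: wp_seq; apply: wp_const; [by [] | by lia |].
apply: wp_seq; apply: wp_const; [by [] | by lia |].
have mem2 : nth 0 w 2 = size (kexpr_code e) by rewrite def_w.
apply: wp_seq; apply: wp_load; rewrite ?upd_eq //= ?mem2 //.
apply: wp_const => //; first by lia.
by split=> //=; rewrite muln0 addn0.
Qed.

Lemma uct_program_run (e : kexpr k) l g :
  w = int_code l ++ (size (kexpr_code e) :: kexpr_code e) ++ g ->
  exists (b : bool) f,
    [/\ run W uct_program
          (cost prologue + ((cost (token k)).+2 * size (kexpr_code e) +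
             (cost epilogue + 2).+1)) (init w) = Some b,
        table_for (kgraph e) f &
        b <-> exists2 t, accepting t &
          (if (l < 0)%R then 0 else `|l|%N) < f t].
Proof.
move=> def_w; have [pro start _ _ fin] := uct_program_code.
have [fin1 fin2] := infix_at_cat fin.
have [verdict halts] := infix_at_cons fin2.
have [yes halt] := infix_at_cons halts; have [no _] := infix_at_cons halt.
have sw : 3 + size (kexpr_code e) <= size w.
  by rewrite def_w /= size_cat; lia.
have [n0 [rg0 [mm0 [le0 st0 z0 cfg0]]]] := wp_prologue def_w (erefl _) pro.
have code : infix_at w 3 (kexpr_code e ++ [::]).
  exists [:: nat_of_bool (l < 0)%R; `|l|%N; size (kexpr_code e)], g.
  by rewrite cats0 def_w.
(* The rest after the expression is empty because register 3 counts only the words of the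
   expression. *)
rewrite -[X in size X]cats0 in cfg0.
have [|n1 [rg1 [mm1 [le1 st1 z1 [f tf cfg1]]]]] := evaluation code cfg0 z0.
  by rewrite add0n; lia.
have fW t : f t < W.
  by have := table_for_bound t tf; have := card_kgraph_code e; lia.
have [|n2 [rg2 [mm2 [le2 st2 _ ans]]]] := wp_epilogue cfg1 _ fW z1 fin1.
  by lia.
have [_ _ _ r3 _] := cfg1.
exists (rg2 4 != 0), f; split=> //.
  apply: run_leq (_ : n0 + (n1 + (n2 + 2).+1) <= _) _.
    by rewrite leq_add // leq_add // ltnS leq_add2r.
  apply: run_steps st0 _; apply: run_steps st1 _.
  apply: run_jump start _; rewrite r3; apply: run_steps st2 _.
  apply: run_jump verdict _; case: eqP => _; exact: run_halt.
rewrite (_ : (rg2 4 != 0) <-> (rg2 4 <> 0)); last by split=> /eqP.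
by rewrite ans def_w /=; case: (l < 0)%R.
Qed.

End Program.

(** * Correctness of the answer and the linear bound *)

Lemma uct_table k (G : lgraph k) f l :
  table_for G f ->
  upper_clique_transversal G l <->
  exists2 t, accepting t & (if (l < 0)%R then 0 else `|l|%N) < f t.
Proof.
case=> lo hi; split=> [[S [mS lS]]|[t acc lt_t]].
  exists (uct_type S); first by rewrite acceptingE.
  by apply: leq_trans (lo S); rewrite ltnS; case: ifP; lia.
case: (hi t) lt_t => [->//|[S St ->]]; rewrite ltnS => lS.
exists S; rewrite -acceptingE St; split=> //.
by move: lS; case: ifP; lia.
Qed.

(** The base [B] of the power is at least 2 and [c <= 2 ^ (c - 1)], so the capacity is at least
    [B * c], hence at least [B * (M + 8)]. This exceeds every address and value used. *)
Lemma capacity_large M c w : M + 8 <= c ->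
  [/\ {in w, forall x, x < capacity c w}, size w + 8 < capacity c w &
      size w + M * size w + M < capacity c w].
Proof.
move=> Mc; rewrite /capacity.
set m := \max_(x <- w) x.
have mW : (size w + m + 2) * (M + 8) <= (size w + m + 2) ^ c.
  case: c Mc => [|c] Mc; first by rewrite addnS in Mc.
  rewrite expnS leq_mul2l; apply/orP; right.
  apply: (@leq_trans (2 ^ c)); last by case: (c) => // d; rewrite leq_exp2r ?leq_addl.
  exact: leq_trans Mc (ltn_expl _ _).
move: (_ ^ c) mW => W; rewrite !mulnDl !mulnDr => mW.
split; [|by lia..] => x xw.
have : x <= m by apply: leq_bigmax_seq.
by lia.
Qed.

Lemma linear_time a t d M n s : n + 3 <= s ->
  a + (t * n + (d + 2).+1) <= (a + t + d + M + 8) * s.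
Proof.
move=> ns; have s0 : 0 < s by lia.
have as_ := leq_pmulr a s0; have ds := leq_pmulr d s0.
have ts : t * n <= t * s by rewrite leq_mul2l; apply/orP; right; lia.
rewrite !mulnDl; lia.
Qed.

Theorem theorem7p1 (k : nat) (hk : 0 < k) :
  solvable_in_linear_time (@uct_repr k) (@uct_yes k).
Proof.
(* One constant is both the factor of the running time and the exponent of the capacity: the costs
   pay for the former, [ntypes k + 8] for the latter. *)
exists (uct_program k),
  (cost prologue + (cost (token k)).+2 + cost (epilogue k) + ntypes k + 8).
move=> [G e eG l] w [g _ def_w].
have [|words sizeW roomW] := @capacity_large (ntypes k)
  (cost prologue + (cost (token k)).+2 + cost (epilogue k) + ntypes k + 8) w.
  by rewrite leq_add2r leq_addl.
have [b [f [acc tf ans]]] := uct_program_run words sizeW roomW def_w.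
exists b; split.
  apply: run_leq acc; apply: linear_time.
  by rewrite def_w /= size_cat addn3 !ltnS leq_addr.
(* The table describes the graph built by the expression; the answer is carried over to the
   isomorphic input graph. *)
rewrite ans -(uct_table l tf); exact: upper_clique_transversal_iso.
Qed.
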